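(* Let $n\ge 2$ and let $\gamma\colon[0,1]\to S^{n-1}$ be a $C^1$ curve for which there exists $C=C(\gamma)<\infty$ such that $$\mathcal{H}^{n-1}\big\{\xi\in S^{n-1}:\ \operatorname{card}\{t\in[0,1]:\gamma'(t)\cdot\xi=0\}>C\big\}=0.$$ Suppose that $K_\gamma$ is a bounded set in $\mathbb{R}^n$ containing a unit segment in each direction of the curve $\gamma$; that is, for each $\omega\in\gamma([0,1])$ there is $a\in\mathbb{R}^n$ with $\{a+s\omega: 0\le s\le 1\}\subset K_\gamma$. Then $$\dim_H(K_\gamma)\ge 2.$$
   Context: $S^{n-1}$ is the unit sphere in $\mathbb{R}^n$, $\mathcal{H}^{n-1}$ is $(n-1)$-dimensional Hausdorff measure, $\operatorname{card}$ denotes cardinality, and $\dim_H$ denotes Hausdorff dimension. *)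

(* Defs.v *)
From HB Require Import structures.
From mathcomp Require Import all_boot all_order all_algebra.
From mathcomp Require Import all_classical all_reals all_analysis.

Set Implicit Arguments.
Unset Strict Implicit.
Unset Printing Implicit Defensive.

Import Order.TTheory GRing.Theory Num.Theory.
Import numFieldNormedType.Exports.

Local Open Scope classical_set_scope.
Local Open Scope ring_scope.

Definition dotv (R : realType) (n : nat) (x y : 'rV[R]_n) : R :=
  \sum_(i < n) x 0 i * y 0 i.

(* The library norm `|x| on 'rV[R]_n is the sup norm; lengths, diameters and
   the unit sphere below use the Euclidean norm. *)
Definition enorm (R : realType) (n : nat) (x : 'rV[R]_n) : R :=
  Num.sqrt (dotv x x).

Definition unit_sphere (R : realType) (n : nat) : set 'rV[R]_n :=
  [set x | enorm x = 1].
Arguments unit_sphere : clear implicits.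

(* This is -oo on the empty set, which hausdorff_gauge treats separately. *)
Definition ediam (R : realType) (n : nat) (A : set 'rV[R]_n) : \bar R :=
  ereal_sup [set z | exists x y, [/\ A x, A y & z = (enorm (x - y))%:E]].

(* diam(A)^s with 0^0 = 1, so that the 0-dimensional measure counts points,
   and with value 0 on the empty set for every s. *)
Definition hausdorff_gauge (R : realType) (n : nat) (s : R)
    (A : set 'rV[R]_n) : \bar R :=
  if A == set0 then 0%E else (ediam A `^ s)%E.

Definition hausdorff_content (R : realType) (n : nat) (s delta : R)
    (A : set 'rV[R]_n) : \bar R :=
  ereal_inf [set (\sum_(0 <= k <oo) hausdorff_gauge s (U k))%E |
    U in [set U : nat -> set 'rV[R]_n |
      A `<=` \bigcup_k U k /\ forall k, (ediam (U k) <= delta%:E)%E]].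

(* s-dimensional Hausdorff outer measure, defined on all subsets of R^n and
   without a normalizing constant. *)
Definition hausdorff_measure (R : realType) (n : nat) (s : R)
    (A : set 'rV[R]_n) : \bar R :=
  ereal_sup [set hausdorff_content s delta A |
    delta in [set delta : R | 0 < delta]].

Definition hausdorff_dim (R : realType) (n : nat) (A : set 'rV[R]_n) : \bar R :=
  ereal_inf [set s%:E |
    s in [set s : R | 0 <= s /\ hausdorff_measure s A = 0%E]].

(* A curve on [0, 1] is a function on R of which only the values on [0, 1]
   matter: difference quotients are taken inside [0, 1], hence one-sided
   derivatives at 0 and 1. *)
Definition curve_quotient (R : realType) (n : nat) (g : R -> 'rV[R]_n)
    (t s : R) : 'rV[R]_n :=
  (s - t)^-1 *: (g s - g t).

Definition curve_deriv (R : realType) (n : nat) (g : R -> 'rV[R]_n)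
    (t : R) : 'rV[R]_n :=
  lim (curve_quotient g t s @[s --> within `[0, 1] t^']).

Definition C1_curve (R : realType) (n : nat) (g : R -> 'rV[R]_n) : Prop :=
  (forall t, t \in `[0, 1] ->
     cvg (curve_quotient g t s @[s --> within `[0, 1] t^'])) /\
  {within `[0, 1], continuous (curve_deriv g)}.

(* Main.v *)
Require Import Defs.
From HB Require Import structures.
From mathcomp Require Import all_boot all_order all_algebra.
From mathcomp Require Import all_classical all_reals all_analysis.
From mathcomp Require Import measurable_realfun.
From mathcomp Require Import ring lra.

Set Implicit Arguments.
Unset Strict Implicit.
Unset Printing Implicit Defensive.

Import Order.TTheory GRing.Theory Num.Theory.
Import numFieldNormedType.Exports.

Local Open Scope classical_set_scope.
Local Open Scope card_scope.
Local Open Scope ring_scope.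

(* The cardinality hypothesis excludes constant curves, for which every
   direction of the sphere (a set of positive measure) would be exceptional.
   Put u = g 0 and w = g t1, where t1 is the first time at which u . g drops to
   some v in [1/2, 1). By the intermediate value theorem every slope th in
   [v, 1/v] is realised: w . g s = th * (u . g s) for some s <= t1. Hence the
   image of K under x |-> (u . x, w . x) contains a segment of each slope in an
   interval, and it suffices to bound covers of such a planar set from below.

   Cover it by sets of diameter d_k, and choose N segments with well separated
   slopes, N equidistant points on each, and for each point a set of the cover
   containing it; a_k counts the points assigned to the k-th set. Two segments
   of slopes th, th' meet the same set only near their crossing point: at
   distance at most about d_k / |th - th'|. Weighing by d_k ^ (1 + t), t < 1,
   the energy \sum_k a_k ^ 2 / d_k ^ (1 + t) is therefore at most a multiple of
   \sum_(i, i') \sum_j N (|j - z| |i - i'|) ^ (- t) after rescaling, which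
   is of order N ^ 4, and Cauchy-Schwarz bounds \sum_k d_k ^ (1 + t) below.

   No measurability of the choice of the segments is available. A set of slopes
   whose segments are covered by the first k sets, for one fixed k, is found by
   applying continuity of Lebesgue measure to unions of grid cells only. *)

(** * Sums of negative powers *)

(** Young's inequality for [x ^ p] and [1] with the conjugate exponents [1 / p] and
    [1 / (1 - p)]. *)
Lemma bernoulli_powR (R : realType) (p x : R) :
  0 < p < 1 -> 0 <= x -> x `^ p <= 1 + p * (x - 1).
Proof.
move=> /andP[p0 p1] x0.
have q0 : 0 < 1 - p by rewrite subr_gt0.
have := @conjugate_powR R (x `^ p) 1 p^-1 (1 - p)^-1 (powR_ge0 _ _) ler01.
rewrite !invr_gt0 p0 q0 !invrK subrKC => /(_ isT isT erefl).
rewrite -powRrM divff ?gt_eqF// powRr1// powR1 mulr1 mul1r => /le_trans; apply.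
by lra.
Qed.

(** Concavity of the power: after factoring out [(N + 1) ^ p], this is Bernoulli's inequality at
    [N / (N + 1)]. *)
Lemma powRS_ge (R : realType) (p : R) (N : nat) : 0 < p < 1 ->
  p * N.+1%:R `^ (p - 1) <= N.+1%:R `^ p - N%:R `^ p.
Proof.
move=> hp; have [p0 p1] := andP hp.
have S0 : 0 < N.+1%:R :> R by rewrite ltr0n.
have -> : N%:R `^ p = N.+1%:R `^ p * (N%:R / N.+1%:R) `^ p :> R.
  by rewrite -powRM ?divr_ge0 ?ler0n// mulrC divfK ?gt_eqF.
have -> : N.+1%:R `^ (p - 1) = N.+1%:R `^ p * N.+1%:R^-1 :> R.
  by rewrite powRB ?powRr1 ?ltW// (gt_eqF S0) implybT.
have hB := bernoulli_powR hp (divr_ge0 (ler0n R N) (ltW S0)).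
have -> : p * (N.+1%:R `^ p * N.+1%:R^-1) = N.+1%:R `^ p * (p * N.+1%:R^-1) :> R
  by ring.
rewrite -[X in _ <= X - _]mulr1 -mulrBr ler_wpM2l ?powR_ge0//.
rewrite lerBrDl -lerBrDr; apply: (le_trans hB).
rewrite -natr1 in S0 *; rewrite le_eqVlt; apply/orP; left; apply/eqP; field.
by rewrite gt_eqF.
Qed.

Definition trunc_norm (R : realType) (y : R) : R := Num.max 1 `|y|.

Lemma trunc_norm_ge1 (R : realType) (y : R) : 1 <= trunc_norm y.
Proof. by rewrite /trunc_norm le_max lexx. Qed.

Lemma trunc_norm_gt0 (R : realType) (y : R) : 0 < trunc_norm y.
Proof. exact: lt_le_trans ltr01 (trunc_norm_ge1 y). Qed.

Lemma sum_trunc_norm_powR (R : realType) (t : R) (N : nat) (z : R) :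
  0 < t < 1 ->
  \sum_(j < N) trunc_norm (j%:R - z) `^ (- t)
    <= 4 / (1 - t) * N%:R `^ (1 - t).
Proof.
(* induction on [N]: remove an end of the range at distance >= N / 2 from z *)
move=> ht; have [t0 t1] := andP ht.
have hp : 0 < 1 - t < 1 by apply/andP; split; lra.
have p0 : 0 < 1 - t by lra.
elim: N z => [|N IH] z.
  by rewrite big_ord0 mulr_ge0 ?powR_ge0// divr_ge0// ltW.
have := powRS_ge N hp; rewrite [1 - t - 1]addrAC subrr add0r => hS.
(* The truncated distance exceeds both 1 and [N / 2], hence [(N + 1) / 4]; the factor 4 bounds
   [4 ^ t]. *)
have key y : N%:R / 2 <= `|y| ->
    trunc_norm y `^ (- t) <= 4 * N.+1%:R `^ (- t).
  move=> hy; have hm : N.+1%:R / 4 <= trunc_norm y.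
    have := trunc_norm_ge1 y; have : `|y| <= trunc_norm y.
      by rewrite /trunc_norm le_max lexx orbT.
    by rewrite -natr1; lra.
  have S0 : 0 < N.+1%:R :> R by rewrite ltr0n.
  rewrite !powRN.
  apply: (@le_trans _ _ ((N.+1%:R / 4) `^ t)^-1).
    rewrite lef_pV2 ?posrE ?powR_gt0 ?trunc_norm_gt0 ?divr_gt0//.
    rewrite ge0_ler_powR ?(ltW t0) ?nnegrE ?divr_ge0 ?(ltW S0)//.
    by rewrite ltW// trunc_norm_gt0.
  have -> : (N.+1%:R / 4) `^ t = N.+1%:R `^ t * 4^-1 `^ t :> R.
    by rewrite powRM ?(ltW S0)// invr_ge0.
  rewrite invfM mulrC ler_wpM2r ?invr_ge0 ?powR_ge0//.
  rewrite -powR_inv1// -powRrM mulN1r powRN invrK.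
  by rewrite -[leRHS]powRr1// ler_powR// ?ltW//; lra.
have step : 4 / (1 - t) * N%:R `^ (1 - t) + 4 * N.+1%:R `^ (- t)
    <= 4 / (1 - t) * N.+1%:R `^ (1 - t).
  rewrite -lerBrDl -mulrBr.
  apply: (@le_trans _ _ (4 / (1 - t) * ((1 - t) * N.+1%:R `^ (- t)))).
    by rewrite mulrA divfK ?gt_eqF.
  by rewrite ler_wpM2l// divr_ge0// ltW.
(* If the last index is close to [z], then index 0 is far from it; removing index 0 shifts [z] by
   one. *)
have [hz|hz] := lerP (N%:R / 2) `|N%:R - z|.
  rewrite big_ord_recr/=; apply: le_trans step.
  by apply: lerD; [exact: IH|exact: key].
rewrite big_ord_recl/= addrC; apply: le_trans step; apply: lerD.
  rewrite (eq_bigr (fun j : 'I_N => trunc_norm (j%:R - (z - 1)) `^ (- t))).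
    exact: IH.
  by move=> j _; rewrite /bump/= add1n -natr1; congr (trunc_norm _ `^ _); ring.
apply: key; rewrite sub0r normrN.
have := ler_normD (N%:R - z) z; rewrite subrK normr_nat; lra.
Qed.

(** * Lebesgue measure and covers *)

Lemma lebesgue_measure_itvcc (R : realType) (a b : R) : a <= b ->
  lebesgue_measure `[a, b]%classic = (b - a)%:E.
Proof.
move=> ab; have := lebesgue_measure_itv `[a, b]; rewrite /= lte_fin => ->.
case: ltgtP ab => // -> _; by rewrite subrr.
Qed.

Lemma measure_bigsetU_le (d : measure_display) (T : measurableType d)
    (R : realType) (mu : {measure set T -> \bar R}) (n : nat)
    (F : 'I_n -> set T) (c : 'I_n -> R) :
  (forall i, measurable (F i)) -> (forall i, (mu (F i) <= (c i)%:E)%E) ->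
  (mu (\big[setU/set0]_(i < n) F i) <= (\sum_(i < n) c i)%:E)%E.
Proof.
elim: n F c => [|n IH] F c mF hF; first by rewrite !big_ord0 measure0.
rewrite !big_ord_recr/= EFinD.
apply: (le_trans (measureU2 _ _ _)) => //; first exact: bigsetU_measurable.
by apply: leeD; [exact: IH|exact: hF].
Qed.

(** Measure is applied only to the union of the cells meeting [X k], which contains the part of
    [X k] in [0, 1]. The mesh may depend on [k], so that it can later be adapted to the first [k]
    sets of a cover. *)
Lemma many_cells_hit (R : realType) (X : nat -> set R) (N : nat -> nat) :
  (forall k, (0 < N k)%N) ->
  (forall x : R, x \in `[0, 1] -> \forall k \near \oo, X k x) ->
  exists k (G : {set 'I_(N k)}) (tau : 'I_(N k) -> R),
    (N k <= 2 * #|G|)%N /\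
    forall i, i \in G -> X k (tau i) /\
      i%:R / (N k)%:R <= tau i <= i.+1%:R / (N k)%:R.
Proof.
move=> N0 XT.
pose cell k (i : nat) : set (measurableTypeR R) :=
  `[i%:R / (N k)%:R, i.+1%:R / (N k)%:R]%classic.
pose G k : {set 'I_(N k)} :=
  [set i : 'I_(N k) | `[< X k `&` cell k i !=set0 >]]%SET.
have [[k hk]|small] := pselect (exists k, (N k <= 2 * #|G k|)%N).
  have hit (i : 'I_(N k)) : exists t, i \in G k -> X k t /\ cell k i t.
    have [|_] := boolP (i \in G k); last by exists 0.
    by rewrite inE => /asboolP[t ht]; exists t.
  have [tau htau] := choice hit.
  by exists k, (G k), tau; split => // i /htau[? /=]; rewrite in_itv.
exfalso.
(* otherwise [0, 1] lies in the liminf of sets of measure at most 1/2 *)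
pose mu : {measure set (measurableTypeR R) -> \bar R} := @lebesgue_measure R.
pose O k : set (measurableTypeR R) :=
  \big[setU/set0]_(i < N k) (if i \in G k then cell k i else set0).
have mO k : measurable (O k).
  by apply: bigsetU_measurable => i _; case: ifP => _ //; exact: measurable_itv.
have muO k : (mu (O k) <= 2^-1%:E)%E.
  pose c (i : 'I_(N k)) : R := if i \in G k then (N k)%:R^-1 else 0.
  apply: (le_trans (measure_bigsetU_le (c := c) _ _)); rewrite {}/c.
  - by move=> i; case: ifP => _ //; exact: measurable_itv.
  - move=> i; case: ifP => _; last by rewrite measure0 lee_fin.
    rewrite [mu _]lebesgue_measure_itvcc.
      by rewrite lee_fin -mulrBl -natr1 addrAC subrr add0r mul1r.
    by rewrite ler_wpM2r// ?invr_ge0// ler_nat.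
  rewrite lee_fin -big_mkcond/= sumr_const.
  have Nk0 : 0 < (N k)%:R :> R by rewrite ltr0n.
  have : ((2 * #|G k|)%:R <= (N k)%:R :> R).
    by rewrite ler_nat ltnW// ltnNge; apply/negP => h; apply: small; exists k.
  by rewrite -[_^-1 *+ _]mulr_natl ler_pdivrMr// natrM; lra.
pose B k := \bigcap_(j in [set j | (k <= j)%N]) O j.
have mB k : measurable (B k).
  by apply: bigcap_measurable => [|j _]; [exists k => /=|].
have muB k : (mu (B k) <= 2^-1%:E)%E.
  apply: le_trans (muO k); apply: le_measure; rewrite ?inE//.
  by move=> x; apply => /=.
have cvgB : mu \o B @ \oo --> mu (\bigcup_k B k).
  apply: nondecreasing_cvg_mu => //; first exact: bigcup_measurable.
  apply/nondecreasing_seqP => k; apply/subsetPset => x Bx j /= hj.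
  by apply: Bx => /=; exact: ltnW.
have : (mu `[0%R, 1%R]%classic <= 2^-1%:E)%E.
  apply: (@le_trans _ _ (mu (\bigcup_k B k))).
    apply: le_measure; rewrite ?inE//; first exact: bigcup_measurable.
    move=> x /= x01; have [k _ hk] := XT x x01.
    exists k => // j /= kj; have Xj : X j x by apply: hk.
    have Nj0 : 0 < (N j)%:R :> R by rewrite ltr0n.
    have [x0 x1] : 0 <= x /\ x <= 1 by move: x01; rewrite in_itv/= => /andP[].
    have [i hi] : exists i : 'I_(N j), cell j i x.
      (* The point 1 belongs to the last cell, whereas truncation would give the index [N j], one
         too large. *)
      have [->|xn1] := eqVneq x 1.
        have hN : ((N j).-1 < N j)%N by rewrite prednK.
        exists (Ordinal hN); rewrite /cell/= in_itv/= prednK//.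
        rewrite divff ?gt_eqF// lexx andbT ler_pdivrMr// mul1r ler_nat.
        exact: leq_pred.
      have xlt : x < 1 by rewrite lt_neqAle xn1.
      have hx : 0 <= x * (N j)%:R by rewrite mulr_ge0// ltW.
      have /andP[h1 h2] := truncn_itv hx.
      have hN : (Num.truncn (x * (N j)%:R) < N j)%N.
        rewrite -(ltr_nat R); apply: (le_lt_trans h1).
        by rewrite gtr_pMl.
      exists (Ordinal hN); rewrite /cell/= in_itv/=.
      by rewrite ler_pdivrMr// h1/= ler_pdivlMr// ltW.
    rewrite /O (bigD1 i)//=; left; rewrite ifT// inE.
    by apply/asboolP; exists x.
  rewrite -(cvg_lim _ cvgB)//; apply: lime_le.
    by apply/cvg_ex; eexists; exact: cvgB.
  exact: nearW.
by rewrite [mu _]lebesgue_measure_itvcc// lee_fin; lra.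
Qed.

(** Volume comparison for a cover of the unit cube by boxes of half-side [d k]. The index set [A]
    varies so that the induction can pass to the boxes meeting a given slice; points are sequences
    of which only the first [m] terms are constrained. *)
Lemma cube_cover_mass (R : realType) (m : nat) (A : set nat)
    (c : nat -> nat -> R) (d : nat -> R) :
  (forall k, 0 <= d k) ->
  (forall z : nat -> R, (forall i, 0 <= z i <= 1) ->
     exists2 k, A k & forall i, (i < m)%N -> `|z i - c k i| <= d k) ->
  (1%:E <= \sum_(0 <= k <oo) ((2 * d k) ^+ m * \1_A k)%:E)%E.
Proof.
(* induction on the dimension, integrating over the last coordinate *)
move=> d0.
elim: m A => [|m IH] A hA.
  (* In dimension 0 each index of [A] contributes 1, and the cover provides one such index. *)
  have [k Ak _] := hA (fun=> 0) (fun=> ltac:(by rewrite lexx ler01)).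
  apply: le_trans (@nneseries_lim_ge _ _ xpredT 0%N k.+1 _); last first.
    by move=> n _ _; rewrite lee_fin mulr_ge0// expr0.
  rewrite big_nat_recr//= expr0 mul1r indicE mem_set//.
  rewrite -[leLHS]add0e leeD2r// sume_ge0// => i _.
  by rewrite lee_fin mulr_ge0// expr0.
pose I k : set (measurableTypeR R) := `[c k m - d k, c k m + d k]%classic.
have slice x : x \in `[0, 1] ->
    (1%:E <= \sum_(0 <= k <oo) (((2 * d k) ^+ m * \1_A k) * \1_(I k) x)%:E)%E.
  move=> x01.
  have -> : (\sum_(0 <= k <oo) ((2 * d k) ^+ m * \1_A k * \1_(I k) x)%:E =
      \sum_(0 <= k <oo) ((2 * d k) ^+ m * \1_(A `&` [set k | I k x]) k)%:E)%E.
    apply: eq_eseriesr => k _; rewrite -mulrA; congr ((_ * _)%:E).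
    rewrite !indicE -natrM mulnb; congr (_%:R); congr nat_of_bool.
    apply/idP/idP => [/andP[/set_mem Ak /set_mem Ik]|/set_mem[Ak Ik]].
      exact: mem_set.
    by apply/andP; split; exact: mem_set.
  apply: IH => z z01.
  have [i|k Ak hk] := hA (fun i => if i == m then x else z i).
    by case: ifP => _//; rewrite -in_itv.
  exists k.
    split => //=; rewrite /I/= in_itv/=.
    by have := hk m (ltnSn m); rewrite eqxx ler_norml => /andP[]; lra.
  move=> i im; have := hk i (ltnW im).
  by rewrite (ltn_eqF im).
pose mu := @lebesgue_measure R.
have mI k : measurable (I k) by exact: measurable_itv.
have m01 : measurable (`[0%R, 1%R]%classic : set (measurableTypeR R)).
  exact: measurable_itv.
have w0 k : 0 <= (2 * d k) ^+ m * \1_A k.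
  by rewrite mulr_ge0// exprn_ge0// mulr_ge0.
apply: (@le_trans _ _ (\int[mu]_(x in `[0%R, 1%R]) 
  (\sum_(0 <= k <oo) ((2 * d k) ^+ m * \1_A k * \1_(I k) x)%:E))%E).
  have <- : (\int[mu]_(x in `[0%R, 1%R]) cst 1%:E x = 1%:E)%E.
    rewrite integral_cst// mul1e.
    have := lebesgue_measure_itv `[0:R, 1].
    by rewrite /= lte_fin ltr01 -EFinD subr0.
  apply: ge0_le_integral => //.
    apply: ge0_emeasurable_sum => [k x _ _|k _].
      by rewrite lee_fin mulr_ge0.
    apply/measurable_EFinP; apply: measurable_funM.
      exact: measurable_cst.
    exact: measurable_indic.
rewrite integral_nneseries//; last 2 first.
- move=> k; apply/measurable_EFinP; apply: measurable_funM.
    exact: measurable_cst.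
  exact: measurable_indic.
- by move=> k x _; rewrite lee_fin mulr_ge0.
apply: lee_nneseries => k _.
  by move=> _; apply: integral_ge0 => x _; rewrite lee_fin mulr_ge0.
rewrite (eq_integral (fun x =>
    ((2 * d k) ^+ m * \1_A k)%:E * (\1_(I k) x)%:E)%E); last first.
  by move=> x _; rewrite EFinM.
rewrite ge0_integralZl//; last 2 first.
- by apply/measurable_EFinP; exact: measurable_indic.
- by rewrite lee_fin.
rewrite integral_indic//.
have -> : (2 * d k) ^+ m.+1 * \1_A k = (2 * d k) ^+ m * \1_A k * (2 * d k).
  by rewrite exprSr mulrAC.
rewrite [leRHS]EFinM; apply: lee_wpmul2l; first by rewrite lee_fin.
apply: (@le_trans _ _ (mu (I k))).
  by apply: le_measure; rewrite ?inE//; exact: measurableI.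
have -> : mu (I k) = (c k m + d k - (c k m - d k))%:E.
  by apply: lebesgue_measure_itvcc; have := d0 k; lra.
by rewrite lee_fin; lra.
Qed.

(** * Covers of segments of distinct slopes *)

Lemma ge_powRN (R : realType) (t x y : R) : 0 < t -> 0 < x -> x <= y ->
  y `^ (- t) <= x `^ (- t).
Proof.
move=> t0 x0 xy; have y0 := lt_le_trans x0 xy.
rewrite !powRN lef_pV2 ?posrE ?powR_gt0//.
by apply: ge0_ler_powR => //; rewrite ?nnegrE ltW.
Qed.

Lemma sum_eqn_mul (R : realType) (K k : nat) (f : nat -> R) : (k < K)%N ->
  \sum_(q < K) (k == q)%:R * f q = f k.
Proof.
move=> kK; rewrite (bigD1 (Ordinal kK))//= eqxx mul1r big1 ?addr0// => i.
by rewrite -val_eqE/= eq_sym => /negbTE ->; rewrite mul0r.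
Qed.

(** The indicator of [[-x, x]] at [u] is at most the increment from [u] to [u + 1] of the truncation
    to [[-x, x + 1]]; the increments telescope. *)
Lemma card_near_le (R : realType) (N : nat) (y x : R) : 0 <= x ->
  \sum_(j < N) (`|j%:R - y| <= x)%R%:R <= 2 * x + 1.
Proof.
move=> x0.
pose clamp (u : R) := Num.max (- x) (Num.min u (x + 1)).
apply: (@le_trans _ _ (\sum_(0 <= j < N)
    (clamp (j.+1%:R - y) - clamp (j%:R - y)))).
  rewrite big_mkord; apply: ler_sum => j _.
  have clampS u : (- x <= u <= x)%R%:R <= clamp (u + 1) - clamp u.
    rewrite /clamp; have [/andP[? ?]|_] := boolP (- x <= u <= x);
      rewrite ?mulr1n ?mulr0n; case: (lerP (u + 1)) => ?;
      case: (lerP u) => ?; do !case: (lerP (- x)) => ?; lra.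
  by rewrite -natr1 ler_norml addrAC; exact: clampS.
rewrite telescope_sumr// /clamp.
case: (lerP (N%:R - y)) => ?; case: (lerP (0 - y)) => ?;
  do !case: (lerP (- x)) => ?; lra.
Qed.

(** The discrete energy argument: [k i j] is the set assigned to the [j]-th point of the [i]-th
    segment. The energy is at most [6 C ^ 2 n ^ 4] with [C = 4 / (1 - t)], while at least
    [n ^ 2 / 2] points are assigned. Since [n * D q >= 1], no set is finer than the grid. *)
Lemma energy_count (R : realType) (t : R) (N K : nat) (D : nat -> R)
    (G : {set 'I_N}) (tau : 'I_N -> R) (k : 'I_N -> 'I_N -> nat) :
  0 < t < 1 -> (0 < N)%N -> (N <= 2 * #|G|)%N ->
  (forall q, (q < K)%N -> 1 <= N%:R * D q) ->
  (forall i j, i \in G -> (k i j < K)%N) ->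
  (forall i, i \in G -> i%:R / N%:R <= tau i <= i.+1%:R / N%:R) ->
  (forall i j j', i \in G -> k i j = k i j' ->
     `|j%:R / N%:R - j'%:R / N%:R| <= D (k i j)) ->
  (forall i i', i \in G -> i' \in G -> exists z, forall j j', k i j = k i' j' ->
     `|j%:R / N%:R - z| * `|tau i - tau i'| <= D (k i j)) ->
  (24 * (4 / (1 - t)) ^+ 2)^-1 <= \sum_(q < K) D q `^ (1 + t).
Proof.
move=> ht N_gt0 GN DN kK cell sep1 sep2; have [t0 t1] := andP ht.
have n0 : 0 < N%:R :> R by rewrite ltr0n.
have n1 : 1 <= N%:R :> R by rewrite ler1n.
set n := N%:R in n0 n1 DN cell sep1 sep2 *.
have D0 q : (q < K)%N -> 0 < D q.
  by move=> /DN h; rewrite -(pmulr_rgt0 _ n0) (lt_le_trans ltr01).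
set C := 4 / (1 - t).
have C0 : 0 < C by rewrite divr_gt0// subr_gt0.
pose a (q : nat) : R := \sum_(i in G) \sum_(j < N) (k i j == q)%:R.
pose E : R := \sum_(q < K) a q ^+ 2 * D q `^ (- (1 + t)).
have suma : n ^+ 2 / 2 <= \sum_(q < K) a q.
  rewrite exchange_big/= (eq_bigr (fun=> n)) => [|i iG]; last first.
    rewrite exchange_big/= (eq_bigr (fun=> 1)) => [|j _].
      by rewrite sumr_const card_ord.
    rewrite -[RHS](sum_eqn_mul (fun=> 1) (kK i j iG)).
    by apply: eq_bigr => q _; rewrite mulr1.
  rewrite sumr_const -[n *+ _]mulr_natr expr2 -mulrA ler_wpM2l ?(ltW n0)//.
  rewrite ler_pdivrMr// -natrM mulnC /n ler_nat.
  by [].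
have ordn (i : 'I_N) : i%:R <= n :> R by rewrite ler_nat ltnW.
have nD i j : i \in G -> 1 <= n * D (k i j) by move=> iG; apply: DN; exact: kK.
(* Both factors can be truncated at 1 because [n * D >= 1] makes the right side at least [2 n]. For
   neighbouring slopes this alone suffices, with [z = 0]. *)
have sepz i i' : exists z, i \in G -> i' \in G ->
    forall j j', k i j = k i' j' ->
    trunc_norm (j%:R - z) * trunc_norm (i'%:R - i%:R : R) <=
      2 * n ^+ 2 * D (k i j).
  have [far|close] := lerP 2 (`|i'%:R - i%:R| : R).
    have [|/not_implyP[iG /not_implyP[i'G _]]] :=
      pselect (i \in G -> i' \in G -> False).
      by move=> h; exists 0 => iG i'G; have := h iG i'G.
    have [z hz] := sep2 _ _ iG i'G; exists (z * n) => _ _ j j' kk.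
    have {hz} := hz _ _ kk; have := nD i j iG; set d := D _ => d1.
    have -> : trunc_norm (i'%:R - i%:R : R) = `|i'%:R - i%:R|.
      by rewrite /trunc_norm; apply/max_idPr; lra.
    (* Points of the two cells differ by at least [(|i' - i| - 1) / n], and here [|i' - i| >= 2]. *)
    have dtau : `|i'%:R - i%:R| / (2 * n) <= `|tau i - tau i'|.
      have := cell _ iG; rewrite ler_pdivrMr// ler_pdivlMr// => /andP[].
      have := cell _ i'G; rewrite ler_pdivrMr// ler_pdivlMr// => /andP[].
      rewrite -[i.+1%:R]natr1 -[i'.+1%:R]natr1 => h1 h2 h3 h4.
      rewrite ler_pdivrMr ?mulr_gt0//.
      have -> : `|tau i - tau i'| * (2 * n) = 2 * `|tau i * n - tau i' * n|.
        by rewrite -mulrBl normrM (gtr0_norm n0); ring.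
      by move: far; do 2 case: ger0P => ?; lra.
    have -> : j%:R / n - z = (j%:R - z * n) / n by field; rewrite gt_eqF.
    rewrite normrM (gtr0_norm (_ : 0 < n^-1)) ?invr_gt0// => hz.
    rewrite /trunc_norm; case: (lerP 1 `|j%:R - z * n|) => [_|_]; last first.
      rewrite mul1r; have ii : `|i'%:R - i%:R| <= n :> R.
        have := ordn i; have := ordn i'; have := ler0n R i; have := ler0n R i'.
        by rewrite ler_norml; lra.
      have : n * 1 <= n * (n * d) by rewrite ler_pM2l.
      have -> : 2 * n ^+ 2 * d = 2 * (n * (n * d)) by ring.
      by lra.
    have := le_trans (ler_wpM2l _ dtau) hz.
    move=> /(_ (divr_ge0 (normr_ge0 _) (ltW n0))).
    have -> : `|j%:R - z * n| / n * (`|i'%:R - i%:R| / (2 * n)) =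
       (`|j%:R - z * n| * `|i'%:R - i%:R|) / (2 * n ^+ 2) :> R.
      by field; rewrite gt_eqF.
    rewrite ler_pdivrMr; first by rewrite [d * _]mulrC.
    by apply: mulr_gt0 => //; exact: exprn_gt0.
  exists 0 => iG _ j j' _; rewrite subr0.
  have m1 : trunc_norm (j%:R : R) <= n.
    by rewrite /trunc_norm ge_max n1 normr_nat ordn.
  have m2 : trunc_norm (i'%:R - i%:R : R) <= 2.
    by rewrite /trunc_norm ge_max (ltW close) andbT; lra.
  apply: (@le_trans _ _ (n * 2)).
    by apply: ler_pM => //; rewrite ltW// trunc_norm_gt0.
  have -> : 2 * n ^+ 2 * D (k i j) = n * 2 * (n * D (k i j)) by ring.
  by apply: ler_peMr; [rewrite mulr_ge0// ltW|exact: nD].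
have /choice[z hz] := fun p => sepz p.1 p.2.
pose W i' i : R := trunc_norm (i'%:R - i%:R) `^ (- t).
pose V i i' j : R := trunc_norm (j%:R - z (i, i')) `^ (- t).
pose B : R := 3 * n * (2 * n ^+ 2) `^ t.
have B0 : 0 <= B by rewrite !mulr_ge0// ?powR_ge0// ltW.
(* At most [3 n D] points of segment [i'] share the set of the point [(i, j)]; if there is one, [hz]
   bounds the remaining [D ^ (- t)]. *)
have local i i' j : i \in G -> i' \in G ->
    (\sum_(j' < N) (k i' j' == k i j)%:R) * D (k i j) `^ (- (1 + t)) <=
    B * (W i' i * V i i' j).
  move=> iG i'G; have d1 := nD i j iG.
  have d0 : 0 < D (k i j) by apply: D0; exact: kK.
  have [[j0 kk]|nkk] := pselect (exists j0, k i' j0 = k i j); last first.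
    rewrite big1 ?mul0r ?mulr_ge0 ?powR_ge0// => j' _.
    by case: eqP => // h; exfalso; apply: nkk; exists j'.
  have cnt : \sum_(j' < N) (k i' j' == k i j)%:R <= 3 * (n * D (k i j)).
    apply: (@le_trans _ _ (\sum_(j' < N)
      (`|j'%:R - j0%:R| <= n * D (k i j))%R%:R)).
      apply: ler_sum => j' _; rewrite ler_nat.
      case: eqP => //= kj'; rewrite lt0b.
      have := @sep1 i' j' j0 i'G; rewrite kj' kk => /(_ erefl).
      rewrite -mulrBl normrM (gtr0_norm (_ : 0 < n^-1)) ?invr_gt0//.
      by rewrite ler_pdivrMr// mulrC.
    by apply: (le_trans (card_near_le _ _ _)); lra.
  apply: (@le_trans _ _ (3 * n * D (k i j) `^ (- t))).
    have -> : 3 * n * D (k i j) `^ (- t) =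
        3 * (n * D (k i j)) * D (k i j) `^ (- (1 + t)).
      rewrite opprD powRD ?(gt_eqF d0) ?implybT//.
      by rewrite powR_inv1 ?(ltW d0)//; field; rewrite gt_eqF.
    by rewrite ler_wpM2r ?powR_ge0.
  rewrite /B -[_ * _ * (W _ _ * _)]mulrA ler_wpM2l ?mulr_ge0 ?(ltW n0)//.
  have := hz (i, i') iG i'G j j0 (esym kk); rewrite /= => hm.
  have n2 : 0 < 2 * n ^+ 2 by rewrite mulr_gt0// exprn_gt0.
  have : (2 * n ^+ 2 * D (k i j)) `^ (- t) <= W i' i * V i i' j.
    rewrite [W _ _ * _]mulrC /V /W -powRM ?(ltW (trunc_norm_gt0 _))//.
    by apply: ge_powRN => //; rewrite mulr_gt0 ?trunc_norm_gt0.
  set X := 2 * n ^+ 2 in n2 *.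
  rewrite powRM ?(ltW n2) ?(ltW d0)// powRN => hX.
  by rewrite -ler_pdivrMl ?powR_gt0.
have VC i i' : \sum_(j < N) V i i' j <= C * n `^ (1 - t).
  exact: sum_trunc_norm_powR.
have WC i : \sum_(i' < N) W i' i <= C * n `^ (1 - t).
  exact: sum_trunc_norm_powR.
have V0 i i' j : 0 <= V i i' j by exact: powR_ge0.
have W0 i i' : 0 <= W i i' by exact: powR_ge0.
(* Expanding the square turns the energy into a sum over pairs of points in a common set. After
   [local], the sums over [G] are enlarged to all indices and the two negative-power sums factor. *)
have Ebound : E <= 6 * C ^+ 2 * n ^+ 4.
  have -> : E = \sum_(i in G) \sum_(j < N) \sum_(i' in G)
      (\sum_(j' < N) (k i' j' == k i j)%:R) * D (k i j) `^ (- (1 + t)).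
    transitivity (\sum_(i in G) \sum_(j < N)
        a (k i j) * D (k i j) `^ (- (1 + t))).
      rewrite /E (eq_bigr (fun q : 'I_K => \sum_(i in G) \sum_(j < N)
          (k i j == q)%:R * (a q * D q `^ (- (1 + t))))); last first.
        move=> q _; rewrite expr2 -mulrA {1}/a mulr_suml.
        by apply: eq_bigr => i _; rewrite mulr_suml.
      rewrite exchange_big/=; apply: eq_bigr => i iG.
      rewrite exchange_big/=; apply: eq_bigr => j _.
      exact: (sum_eqn_mul (fun q => a q * D q `^ (- (1 + t)))) (kK i j iG).
    by apply: eq_bigr => i _; apply: eq_bigr => j _; rewrite mulr_suml.
  apply: (@le_trans _ _ (\sum_(i < N) \sum_(i' < N) \sum_(j < N)
      B * (W i' i * V i i' j))).
    have T0 (i i' : 'I_N) (j : nat) : 0 <= B * (W i' i * V i i' j).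
      by apply: mulr_ge0 => //; exact: mulr_ge0.
    rewrite [leRHS](bigID (mem G))/= -[leLHS]addr0; apply: lerD; last first.
      by do 3 (apply: sumr_ge0 => ? _); exact: T0.
    apply: ler_sum => i iG; rewrite exchange_big/=.
    rewrite [leRHS](bigID (mem G))/= -[leLHS]addr0; apply: lerD; last first.
      by do 2 (apply: sumr_ge0 => ? _); exact: T0.
    apply: ler_sum => i' i'G; apply: ler_sum => j _; exact: local.
  have np0 : 0 <= C * n `^ (1 - t) by rewrite mulr_ge0 ?powR_ge0// ltW.
  apply: (@le_trans _ _ (\sum_(i < N) B * (C * n `^ (1 - t)) ^+ 2)).
    apply: ler_sum => i _.
    apply: (@le_trans _ _ (\sum_(i' < N) B * (W i' i * (C * n `^ (1 - t))))).
      apply: ler_sum => i' _; rewrite -!mulr_sumr.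
      by rewrite ler_wpM2l// ler_wpM2l.
    by rewrite -mulr_sumr -mulr_suml ler_wpM2l// expr2 ler_wpM2r.
  rewrite sumr_const card_ord -[_ *+ N]mulr_natl -/n /B.
  have nt : n `^ t * n `^ (1 - t) = n.
    by rewrite -powRD ?(gt_eqF n0) ?implybT// subrKC powRr1// ltW.
  have -> : (2 * n ^+ 2) `^ t = 2 `^ t * n `^ t ^+ 2.
    by rewrite powRM ?exprn_ge0 ?(ltW n0)// expr2 powRM ?(ltW n0)// -expr2.
  have -> : n * (3 * n * (2 `^ t * n `^ t ^+ 2) * (C * n `^ (1 - t)) ^+ 2) =
      3 * C ^+ 2 * n ^+ 2 * (n `^ t * n `^ (1 - t)) ^+ 2 * 2 `^ t by ring.
  rewrite nt.
  have -> : 6 * C ^+ 2 * n ^+ 4 = 3 * C ^+ 2 * n ^+ 2 * n ^+ 2 * 2 by ring.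
  rewrite ler_wpM2l//.
    by do 3?[apply: mulr_ge0; last exact: sqr_ge0].
  by rewrite -[leRHS]powRr1// ler_powR// ?ltW//; lra.
have S0 : 0 <= \sum_(q < K) D q `^ (1 + t).
  by apply: sumr_ge0 => q _; exact: powR_ge0.
set S := \sum_(q < K) D q `^ (1 + t) in S0 *.
(* weighted AM-GM : 2 a <= l D^s + a^2 D^-s / l, with D^s = D^(1 + t) *)
pose l : R := 12 * C ^+ 2 * n ^+ 2.
have l0 : 0 < l.
  by rewrite /l; apply: mulr_gt0; [apply: mulr_gt0 => //|]; exact: exprn_gt0.
have amgm : 2 * \sum_(q < K) a q <= l * S + E / l.
  rewrite /S /E !mulr_sumr mulr_suml -big_split/=; apply: ler_sum => q _.
  have := powR_gt0 (1 + t) (D0 q (ltn_ord q)); rewrite powRN.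
  set d := D q `^ _ => d0.
  rewrite -subr_ge0.
  have -> : l * d + a q ^+ 2 / d / l - 2 * a q = (l * d - a q) ^+ 2 / (l * d).
    by field; rewrite !gt_eqF.
  by rewrite divr_ge0 ?sqr_ge0// mulr_ge0// ltW.
(* The value of [l] is chosen so that the energy term absorbs only half of
   [n ^ 2 <= 2 * \sum_q a q]. *)
have El : E / l <= n ^+ 2 / 2.
  rewrite ler_pdivrMr//; apply: (le_trans Ebound).
  rewrite le_eqVlt; apply/orP; left; apply/eqP; rewrite /l.
  by field.
have : n ^+ 2 <= 24 * C ^+ 2 * n ^+ 2 * S.
  have -> : 24 * C ^+ 2 * n ^+ 2 * S = 2 * (l * S) by rewrite /l; ring.
  by lra.
rewrite mulrAC -[X in X <= _]mul1r ler_pM2r ?exprn_gt0// => h.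
have C24 : 0 < 24 * C ^+ 2 by apply: mulr_gt0 => //; exact: exprn_gt0.
by rewrite -[leLHS]mul1r ler_pdivrMr// mulrC.
Qed.

(* [Q k x r] reads: the point of parameter [r] on the segment of slope [x] lies
   in the [k]-th set, whose diameter is comparable to [D k]. *)
Lemma transversal_cover_mass (R : realType) (t : R) (D : nat -> R)
    (Q : nat -> R -> R -> Prop) :
  0 < t < 1 -> (forall k, 0 < D k) ->
  (forall k x r r', Q k x r -> Q k x r' -> `|r - r'| <= D k) ->
  (forall x x' : R, x \in `[0, 1] -> x' \in `[0, 1] ->
     exists z, forall k r r', Q k x r -> Q k x' r' ->
       `|r - z| * `|x - x'| <= D k) ->
  (forall x : R, x \in `[0, 1] -> \forall K \near \oo,
     forall r, r \in `[0, 1] -> exists2 k, (k < K)%N & Q k x r) ->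
  exists K, (24 * (4 / (1 - t)) ^+ 2)^-1 <= \sum_(q < K) D q `^ (1 + t).
Proof.
move=> ht D0 sep1 sep2 cov.
pose X K : set R := [set x | x \in `[0, 1] /\
  forall r, r \in `[0, 1] -> exists2 k, (k < K)%N & Q k x r].
(* The mesh [1 / N] is taken below each of the first [K] sizes. *)
have /choice[N hN] K : exists N, (0 < N)%N /\
    forall q, (q < K)%N -> 1 <= N%:R * D q.
  elim: K => [|K [N [N0 hN]]]; first by exists 1%N.
  exists (maxn N (Num.truncn (D K)^-1).+1); split.
    by rewrite leq_max ltn0Sn orbT.
  move=> q; rewrite ltnS leq_eqVlt => /predU1P[->|qK].
    rewrite -ler_pdivrMr// mul1r; apply: ltW.
    apply: lt_le_trans (truncnS_gt _) _.
    by rewrite ler_nat leq_maxr.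
  apply: le_trans (hN q qK) _; rewrite ler_wpM2r ?(ltW (D0 q))//.
  by rewrite ler_nat leq_maxl.
have [|x x01|K [G [tau [hG htau]]]] := @many_cells_hit R X N.
- by move=> k; case: (hN k).
- by apply: filterS (cov x x01) => K hK; split.
exists K; have [N0 DN] := hN K.
have r01 (j : 'I_(N K)) : j%:R / (N K)%:R \in `[0, 1 : R].
  rewrite in_itv/= divr_ge0//= ler_pdivrMr ?ltr0n// mul1r ler_nat.
  exact: ltnW.
have /choice[k hk] (p : 'I_(N K) * 'I_(N K)) : exists k, p.1 \in G ->
    (k < K)%N /\ Q k (tau p.1) (p.2%:R / (N K)%:R).
  have [pG|] := boolP (p.1 \in G); last by exists 0%N.
  have [[_ /(_ _ (r01 p.2))[k kK Qk]] _] := htau _ pG.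
  by exists k.
apply: (@energy_count R t (N K) K D G tau (fun i j => k (i, j))) => //.
- by move=> i j iG; case: (hk (i, j) iG).
- by move=> i iG; case: (htau i iG).
- move=> i j j' iG kk; have [_ Q1] := hk (i, j) iG.
  by have [_] := hk (i, j') iG; rewrite /= -kk; exact: sep1 Q1.
- move=> i i' iG i'G; have [[t01 _] _] := htau i iG.
  have [[t'01 _] _] := htau i' i'G.
  have [z hz] := sep2 _ _ t01 t'01; exists z => j j' kk.
  have [_ Q1] := hk (i, j) iG; have [_] := hk (i', j') i'G.
  by rewrite /= -kk; exact: hz.
Qed.

(** If points of two segments lie in one set, subtracting [th'] times the difference of first
    coordinates from that of second coordinates eliminates [r'] and leaves at most [3 e]. As
    [al >= 1/2], this yields [6 / T]; the summand 2 serves two points of one segment. *)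
Lemma plane_kakeya_cover_mass (R : realType) (t T th0 : R) (e : nat -> R)
    (U : nat -> set (R * R)) (A B al : R -> R) :
  0 < t < 1 -> 0 < T -> (forall k, 0 < e k) -> (forall k, open (U k)) ->
  (forall k p q, U k p -> U k q ->
     `|p.1 - q.1| <= e k /\ `|p.2 - q.2| <= e k) ->
  (forall x : R, x \in `[0, 1] -> 2^-1 <= al x /\ `|th0 + T * x| <= 2) ->
  (forall x r : R, x \in `[0, 1] -> r \in `[0, 1] -> exists k,
     U k (A x + r * al x, B x + r * (al x * (th0 + T * x)))) ->
  exists K, (24 * (4 / (1 - t)) ^+ 2)^-1
    <= \sum_(q < K) ((6 / T + 2) * e q) `^ (1 + t).
Proof.
move=> ht T0 e0 Uo Ud hal cov.
have L0 : 0 < 6 / T + 2 by rewrite addr_gt0// divr_gt0.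
pose P x r : R * R := (A x + r * al x, B x + r * (al x * (th0 + T * x))).
pose Q k x r := x \in `[0, 1] /\ U k (P x r).
apply: (@transversal_cover_mass R t (fun k => (6 / T + 2) * e k) Q) => //.
- by move=> k; rewrite mulr_gt0.
- move=> k x r r' [x01 Ur] [_ Ur']; have [al2 _] := hal x x01.
  have [+ _] := Ud _ _ _ Ur Ur'; rewrite /P /=.
  have -> : A x + r * al x - (A x + r' * al x) = (r - r') * al x by ring.
  rewrite normrM (ger0_norm (_ : 0 <= al x)); last by lra.
  move=> h; have ek := e0 k.
  have h1 : `|r - r'| * 2^-1 <= `|r - r'| * al x by rewrite ler_wpM2l.
  rewrite mulrDl; have : 0 <= 6 / T * e k by rewrite mulr_ge0 ?divr_ge0 ?ltW.
  by lra.
- move=> x x' x01 x'01; have [<-|xx'] := eqVneq x x'.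
    exists 0 => k r r' _ _; rewrite subrr normr0 mulr0 mulr_ge0 ?ltW//.
  have [al2 _] := hal x x01; have [_ th2] := hal x' x'01.
  have al0 : 0 < al x by lra.
  set th' := th0 + T * x' in th2.
  (* The parameter on the first line at which it crosses the second. *)
  pose z := - ((B x - B x') - th' * (A x - A x')) / (al x * (T * (x - x'))).
  exists z => k r r' [_ Ur] [_ Ur'].
  have [d1 d2] := Ud _ _ _ Ur Ur'.
  have key : al x * T * ((r - z) * (x - x')) =
      ((P x r).2 - (P x' r').2) - th' * ((P x r).1 - (P x' r').1).
    rewrite /z /P /= /th'; field.
    by rewrite subr_eq0 xx' !gt_eqF.
  have : `|al x * T * ((r - z) * (x - x'))| <= 3 * e k.
    rewrite key; apply: (le_trans (ler_normB _ _)); rewrite normrM.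
    have : `|th'| * `|(P x r).1 - (P x' r').1| <= 2 * e k by rewrite ler_pM.
    by lra.
  rewrite normrM (gtr0_norm (mulr_gt0 al0 T0)) normrM.
  set w := `|_| * `|_| => h.
  have w0 : 0 <= w by rewrite mulr_ge0.
  have h1 : 2^-1 * T * w <= al x * T * w by rewrite ler_wpM2r// ler_pM2r.
  have -> : (6 / T + 2) * e k = (6 * e k + 2 * T * e k) / T.
    by field; rewrite gt_eqF.
  rewrite ler_pdivlMr//.
  have : 0 <= T * e k by rewrite mulr_ge0// ltW.
  by lra.
- move=> x x01.
  pose V K r := exists2 k, (k < K)%N & Q k x r.
  (* Compactness of [0, 1] gives one [K] for the whole segment; openness of the sets gives the local
     statement. *)
  suff locV (r : R) : `[0, 1]%classic r ->
      \forall r' \near r & K \near \oo, V K r'.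
    have /compact_near_coveringP cpt := @segment_compact R 0 1.
    exact: (cpt nat \oo V _ locV).
  move=> r01; have [k Uk] := cov x r x01 r01.
  have affine (a b : R) : a + r' * b @[r' --> r] --> a + r * b.
    by apply: cvgD; [exact: cvg_cst|exact: mulrr_continuous].
  have cP : P x r' @[r' --> r] --> P x r.
    by apply: (@cvg_pair _ _ _ (nbhs r) (nbhs _) (nbhs _)); exact: affine.
  have hr : \forall r' \near r, U k (P x r').
    by apply: cP; exact: open_nbhs_nbhs.
  near=> r' K => /=; exists k.
    by near: K; exact: nbhs_infty_gt.
  by split=> //; near: r'.
Unshelve. all: by end_near.
Qed.

(** * Hausdorff measure *)

Lemma enorm0 (R : realType) (n : nat) : enorm (0 : 'rV[R]_n) = 0.
Proof.
by rewrite /enorm /dotv big1 ?sqrtr0// => i _; rewrite mxE mul0r.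
Qed.

Lemma norm_coord_le_enorm (R : realType) (n : nat) (x : 'rV[R]_n) (i : 'I_n) :
  `|x 0 i| <= enorm x.
Proof.
rewrite -sqrtr_sqr ler_wsqrtr// /dotv (bigD1 i)//= expr2 lerDl.
by apply: sumr_ge0 => j _; rewrite -expr2 sqr_ge0.
Qed.

Lemma dotvDr (R : realType) (n : nat) (u x y : 'rV[R]_n) :
  dotv u (x + y) = dotv u x + dotv u y.
Proof.
by rewrite /dotv -big_split; apply: eq_bigr => i _; rewrite mxE mulrDr.
Qed.

Lemma dotvZr (R : realType) (n : nat) (u x : 'rV[R]_n) (c : R) :
  dotv u (c *: x) = c * dotv u x.
Proof.
by rewrite /dotv mulr_sumr; apply: eq_bigr => i _; rewrite mxE mulrCA.
Qed.

Lemma dotvBr (R : realType) (n : nat) (u x y : 'rV[R]_n) :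
  dotv u (x - y) = dotv u x - dotv u y.
Proof. by rewrite -scaleN1r dotvDr dotvZr mulN1r. Qed.

Lemma dotvC (R : realType) (n : nat) (x y : 'rV[R]_n) : dotv x y = dotv y x.
Proof. by apply: eq_bigr => i _; rewrite mulrC. Qed.

Lemma norm_dotv_le (R : realType) (n : nat) (u x : 'rV[R]_n) :
  `|dotv u x| <= (\sum_i `|u 0 i|) * enorm x.
Proof.
apply: (le_trans (ler_norm_sum _ _ _)); rewrite mulr_suml.
apply: ler_sum => i _; rewrite normrM ler_wpM2l//.
exact: norm_coord_le_enorm.
Qed.

Lemma hausdorff_gauge_ge0 (R : realType) (n : nat) (s : R) (A : set 'rV[R]_n) :
  (0 <= hausdorff_gauge s A)%E.
Proof. by rewrite /hausdorff_gauge; case: ifP => // _; exact: poweR_ge0. Qed.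

Lemma ediam_ub (R : realType) (n : nat) (A : set 'rV[R]_n) (x y : 'rV[R]_n) :
  A x -> A y -> ((enorm (x - y))%:E <= ediam A)%E.
Proof. by move=> Ax Ay; apply: ereal_sup_ubound; exists x, y. Qed.

Lemma ediam_ge0 (R : realType) (n : nat) (A : set 'rV[R]_n) :
  A !=set0 -> (0%:E <= ediam A)%E.
Proof. by move=> [x Ax]; have := ediam_ub Ax Ax; rewrite subrr enorm0. Qed.

Lemma ediam_set0 (R : realType) (n : nat) :
  ediam (set0 : set 'rV[R]_n) = -oo%E.
Proof. by apply/ereal_sup_ninfty => z [x [y []]]. Qed.

(** Passage to real diameters. The empty set has diameter [-oo], read as 0 by [fine], so the gauge
    formula is stated for nonempty sets. *)
Lemma fine_ediamP (R : realType) (n : nat) (A : set 'rV[R]_n) (s delta : R) :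
  0 <= delta -> (ediam A <= delta%:E)%E ->
  [/\ 0 <= fine (ediam A) <= delta,
      forall x y, A x -> A y -> enorm (x - y) <= fine (ediam A) &
      A !=set0 -> hausdorff_gauge s A = (fine (ediam A) `^ s)%:E].
Proof.
move=> delta0 Adelta; have [->|/set0P A0] := eqVneq A set0.
  rewrite ediam_set0.
  by split => //=; [rewrite lexx|move=> [x []]].
have Age0 := ediam_ge0 A0.
have Afin : ediam A \is a fin_num.
  by rewrite ge0_fin_numE// (le_lt_trans Adelta) ?ltry.
split.
- by rewrite fine_ge0//= -lee_fin fineK.
- by move=> x y Ax Ay; rewrite -lee_fin fineK//; exact: ediam_ub.
- move=> _; rewrite /hausdorff_gauge ifF; last exact/negbTE/set0P.
  by rewrite -poweR_EFin fineK.
Qed.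

Lemma hausdorff_null_cover (R : realType) (n : nat) (s eps delta : R)
    (A : set 'rV[R]_n) :
  hausdorff_measure s A = 0%E -> 0 < eps -> 0 < delta ->
  exists U : nat -> set 'rV[R]_n,
    [/\ A `<=` \bigcup_k U k, forall k, (ediam (U k) <= delta%:E)%E &
        (\sum_(0 <= k <oo) hausdorff_gauge s (U k) < eps%:E)%E].
Proof.
move=> A0 eps0 delta0.
have : (hausdorff_content s delta A < eps%:E)%E.
  apply: (@le_lt_trans _ _ 0%E); last by rewrite lte_fin.
  by rewrite -A0; apply: ereal_sup_ubound; exists delta.
by move=> /ereal_inf_lt[_ [U [AU Ud] <-] Ueps]; exists U.
Qed.

Lemma powRD_le (R : realType) (s x y : R) : 0 <= s <= 2 -> 0 <= x -> 0 <= y ->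
  (x + y) `^ s <= 4 * (x `^ s + y `^ s).
Proof.
move=> /andP[s0 s2] x0 y0.
have two4 : 2 `^ s <= 4 :> R.
  apply: (@le_trans _ _ (2 `^ 2%:R)); first by rewrite ler_powR//; lra.
  by rewrite powR_mulrn//; lra.
wlog xy : x y x0 y0 / x <= y => [hw|].
  have [|/ltW] := lerP x y; first exact: hw.
  by rewrite addrC [x `^ s + _]addrC; exact: hw.
apply: (@le_trans _ _ ((2 * y) `^ s)).
  by apply: ge0_ler_powR => //; rewrite ?nnegrE; lra.
rewrite powRM//; apply: ler_pM; rewrite ?powR_ge0//.
by rewrite lerDr powR_ge0.
Qed.

(** Diameters at most 1 allow the exponent to grow, and adding a geometric sequence makes every size
    positive. *)
Lemma hausdorff_null_powR_cover (R : realType) (n : nat) (s s' eps : R)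
    (A : set 'rV[R]_n) :
  hausdorff_measure s A = 0%E -> s <= s' -> 1 <= s' <= 2 -> 0 < eps ->
  exists (U : nat -> set 'rV[R]_n) (d : nat -> R),
    [/\ A `<=` \bigcup_k U k, forall k, 0 < d k,
        forall k x y, U k x -> U k y -> enorm (x - y) <= d k &
        forall K, \sum_(k < K) d k `^ s' <= eps].
Proof.
move=> A0 ss' /andP[s'1 s'2] eps0.
(* Two sums, each at most [e], are multiplied by the 4 of [powRD_le]. *)
pose e := Num.min 1 (eps / 8).
have e0 : 0 < e by rewrite lt_min ltr01 divr_gt0.
have [e1 e8] : e <= 1 /\ e <= eps / 8 by rewrite !ge_min !lexx orbT.
have [U [AU U1 Ue]] := hausdorff_null_cover A0 e0 ltr01.
pose d k := fine (ediam (U k)).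
have dP k := fine_ediamP s ler01 (U1 k).
have d0 k : 0 <= d k by have [/andP[]] := dP k.
pose h k : R := e * 2^-1 ^+ k.+1.
have h0 k : 0 < h k by rewrite mulr_gt0// exprn_gt0// invr_gt0.
have h1 k : h k <= 1.
  apply: (@le_trans _ _ (e * 1)); last by rewrite mulr1.
  by rewrite ler_pM2l// exprn_ile1//; lra.
have dg k : ((d k `^ s')%:E <= hausdorff_gauge s (U k))%E.
  have [/andP[_ dk1] _ gk] := dP k.
  (* Diameter 0 is separate: the set may be empty, and for [s = 0] the gauge of a point is 1. *)
  have [->|dk0] := eqVneq (d k) 0.
    by rewrite powR0 ?hausdorff_gauge_ge0// gt_eqF//; lra.
  have Uk0 : U k !=set0.
    by apply/set0P/eqP => Uk; move: dk0; rewrite /d Uk ediam_set0 eqxx.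
  by rewrite gk// lee_fin ger_powR// lt_neqAle eq_sym dk0 d0.
have sumd K : \sum_(k < K) d k `^ s' <= e.
  rewrite -lee_fin -sumEFin; apply/ltW; apply: le_lt_trans Ue.
  apply: le_trans (@nneseries_lim_ge _ _ xpredT 0%N K _); last first.
    by move=> k _ _; exact: hausdorff_gauge_ge0.
  by rewrite big_mkord; apply: lee_sum.
have sumh K : \sum_(k < K) h k `^ s' <= e.
  apply: (@le_trans _ _ (e * (1 - 2^-1 ^+ K))); last first.
    by rewrite ler_piMr ?ltW// gerBl exprn_ge0.
  elim: K => [|K IH]; first by rewrite big_ord0 expr0 subrr mulr0.
  rewrite big_ord_recr/=.
  have hK : h K `^ s' <= h K by rewrite ge1r_powR// h0 h1.
  apply: (le_trans (lerD IH hK)).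
  by rewrite /h exprS; lra.
exists U, (fun k => d k + h k); split => //.
- by move=> k; rewrite ltr_wpDl.
- move=> k x y Ux Uy; have [_ /(_ x y Ux Uy) hxy _] := dP k.
  by apply: (le_trans hxy); rewrite lerDl ltW.
- move=> K; apply: (@le_trans _ _ (\sum_(k < K) 4 * (d k `^ s' + h k `^ s'))).
    apply: ler_sum => k _; apply: powRD_le => //; last exact: ltW.
    by rewrite s'2 andbT; lra.
  by rewrite -mulr_sumr big_split/=; have := sumd K; have := sumh K; lra.
Qed.

(** Dropping the last coordinate does not increase distances and maps the sphere onto a set
    containing a cube of side [1 / (m + 1)]. A cover of the sphere thus gives a cover of a cube by
    boxes, of volume bounded below. *)
Lemma unit_sphere_hausdorff_measure_neq0 (R : realType) (m : nat) :
  hausdorff_measure (m.+1%:R - 1) (unit_sphere R m.+1) <> 0%E.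
Proof.
have -> : m.+1%:R - 1 = m%:R :> R by rewrite -natr1 addrK.
pose n1 : R := m.+1%:R.
have n0 : 0 < n1 by rewrite ltr0n.
move=> S0; have c0 : 0 < ((2 * n1) ^+ m)^-1.
  by rewrite invr_gt0 exprn_gt0// mulr_gt0.
have [U [SU U1 Ueps]] := hausdorff_null_cover S0 c0 ltr01.
pose d k := fine (ediam (U k)).
have dP k := fine_ediamP m%:R ler01 (U1 k).
have d0 k : 0 <= d k by have [/andP[]] := dP k.
(* Any point of a nonempty set serves as the centre of its box; empty sets receive the default 0 and
   are left out of [A]. *)
have /choice[q hq] k : exists q, U k !=set0 -> U k q.
  by have [[q Uq]|] := pselect (U k !=set0); [exists q|exists 0].
pose A := [set k | U k !=set0].
have : (1%:E <= \sum_(0 <= k <oo) ((2 * (n1 * d k)) ^+ m * \1_A k)%:E)%E.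
  apply: (@cube_cover_mass R m A (fun k i => n1 * q k 0 (inord i))).
    by move=> k; rewrite mulr_ge0// ltW.
  move=> z z01.
  pose r : R := \sum_(i < m) (z i / n1) ^+ 2.
  have r1 : r <= 1.
    apply: (@le_trans _ _ (\sum_(i < m) n1^-1)).
      apply: ler_sum => i _; have /andP[z0 z1] := z01 i.
      have h0 : 0 <= z i / n1 by rewrite divr_ge0// ltW.
      have h1 : z i / n1 <= n1^-1 by rewrite ler_pdivrMr// mulVf ?gt_eqF.
      have h2 : n1^-1 <= 1 by rewrite invf_le1// ler1n.
      rewrite expr2 -[leRHS]mulr1; apply: ler_pM => //.
      exact: le_trans h1 h2.
    rewrite sumr_const card_ord -[_ *+ m]mulr_natl ler_pdivrMr// mul1r.
    by rewrite ler_nat.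
  pose xi : 'rV[R]_m.+1 := \row_i
    (if (i < m)%N then z i / n1 else Num.sqrt (1 - r)).
  have xiS : unit_sphere R m.+1 xi.
    rewrite /unit_sphere/= /enorm /dotv big_ord_recr/= !mxE/= ltnn -expr2.
    rewrite sqr_sqrtr ?subr_ge0// (eq_bigr (fun i : 'I_m => (z i / n1) ^+ 2)).
      by rewrite subrKC sqrtr1.
    by move=> i _; rewrite !mxE/= ltn_ord expr2.
  have [k _ Uk] := SU _ xiS; have Uk0 : U k !=set0 by exists xi.
  exists k => // i im; have [_ /(_ _ _ Uk (hq k Uk0)) hd _] := dP k.
  have := le_trans (norm_coord_le_enorm _ (inord i)) hd.
  rewrite !mxE inordK ?ltnS ?(ltnW im)// im => h.
  have -> : z i - n1 * q k 0 (inord i) = n1 * (z i / n1 - q k 0 (inord i)).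
    by rewrite mulrBr [n1 * (_ / _)]mulrC divfK ?gt_eqF.
  by rewrite normrM (gtr0_norm n0) ler_pM2l.
apply/negP; rewrite -ltNge.
have -> : (\sum_(0 <= k <oo) ((2 * (n1 * d k)) ^+ m * \1_A k)%:E =
    \sum_(0 <= k <oo) ((2 * n1) ^+ m)%:E * hausdorff_gauge m%:R (U k))%E.
  apply: eq_eseriesr => k _; have [Uk0|Uk0] := pselect (U k !=set0).
    rewrite indicE mem_set// mulr1; have [_ _ ->//] := dP k.
    by rewrite powR_mulrn ?(d0 k)// -EFinM mulrA exprMn.
  rewrite indicE memNset// mulr0 /hausdorff_gauge ifT ?mule0//.
  by apply/eqP/seteqP; split => // x Ux; apply: Uk0; exists x.
rewrite nneseriesZl; last by move=> k _; exact: hausdorff_gauge_ge0.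
have p0 : 0 < (2 * n1) ^+ m by rewrite exprn_gt0// mulr_gt0.
apply: (@lt_le_trans _ _ (((2 * n1) ^+ m)%:E * ((2 * n1) ^+ m)^-1%:E)%E).
  by rewrite lte_pmul2l// lte_fin.
by rewrite -EFinM divff ?gt_eqF.
Qed.

(** * The curve *)

Lemma dotv_continuous (R : realType) (n : nat) (u : 'rV[R]_n) :
  continuous (dotv u).
Proof.
rewrite (_ : dotv u = \sum_i (fun x : 'rV[R]_n => u 0 i * x 0 i)); last first.
  by apply/funext => x; rewrite fct_sumE.
apply: (big_ind (fun f : 'rV[R]_n -> R => continuous f)).
- exact: (@cst_continuous _ _ (0 : R)).
- by move=> f h fc hc x; exact: (cvgD (fc x) (hc x)).
- by move=> i _ x; exact: (cvgMl_tmp (@coord_continuous _ _ _ 0 i x)).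
Qed.

(** The difference quotients converge, hence are bounded near [t]. *)
Lemma dotv_curve_continuous (R : realType) (n : nat) (g : R -> 'rV[R]_n)
    (u : 'rV[R]_n) :
  C1_curve g -> {within `[0, 1], continuous (fun t => dotv u (g t))}.
Proof.
move=> [gd _]; apply/subspace_continuousP => t t01.
have /cvg_ex[l /= gl] := gd t t01.
have Ql :
    dotv u (curve_quotient g t s) @[s --> within `[0, 1] t^'] --> dotv u l.
  by apply: continuous_cvg => //; exact: dotv_continuous.
pose M := `|dotv u l| + 1.
have M0 : 0 < M by rewrite ltr_wpDl.
have QM : \forall s \near within `[0, 1] t^',
    `|dotv u (curve_quotient g t s)| < M.
  by apply: (@cvgr_norm_lt R R _ _ _ _ _ Ql); rewrite ltrDl.
apply/cvgrPdist_lt => e e0; rewrite /within/=.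
have near_t : \forall s \near t, `|t - s| < e / M.
  by apply/nbhs_ballP; exists (e / M); rewrite /= ?divr_gt0.
move: QM; rewrite /within/= /dnbhs /within/= => QM.
apply: filterS2 near_t QM => s st Qs s01.
have [->|sneq] := eqVneq s t; first by rewrite subrr normr0.
have {}Qs := Qs sneq s01.
have st0 : s - t != 0 by rewrite subr_eq0.
have -> : dotv u (g t) - dotv u (g s) =
    (t - s) * dotv u (curve_quotient g t s).
  rewrite /curve_quotient dotvZr dotvBr mulrA.
  by rewrite -[t - s]opprB mulNr divff// mulN1r opprB.
rewrite normrM -[e](divfK (lt0r_neq0 M0)).
by apply: ltr_pM.
Qed.

Lemma within_itv01_dnbhs_proper (R : realType) (t : R) : t \in `[0, 1] ->
  ProperFilter (within `[0, 1] t^').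
Proof.
rewrite in_itv/= => /andP[t0 t1].
apply: Build_ProperFilter_ex => P /=.
rewrite /within/= /dnbhs /within/= => /nbhs_ballP[e /= e0 eP].
pose h := Num.min e 1 / 2.
have h0 : 0 < h by rewrite divr_gt0// lt_min e0 ltr01.
have he : h < e.
  have : Num.min e 1 <= e by rewrite ge_min lexx.
  by move: h0; rewrite /h; lra.
have h2 : h <= 2^-1.
  have : Num.min e 1 <= 1 by rewrite ge_min lexx orbT.
  by rewrite /h; lra.
(* A step of length at most 1/2 away from the nearer endpoint stays in [0, 1]. *)
have [th|th] := lerP t 2^-1; [exists (t + h)|exists (t - h)].
- apply: eP; rewrite /ball/= ?in_itv/=.
  + by rewrite opprD addrA subrr add0r normrN gtr0_norm.
  + by rewrite gt_eqF// ltrDl.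
  + by apply/andP; split; lra.
- apply: eP; rewrite /ball/= ?in_itv/=.
  + by rewrite opprB addrC subrK gtr0_norm.
  + by rewrite lt_eqF// ltrBlDr ltrDl.
  + by apply/andP; split; lra.
Qed.

Lemma curve_deriv_cst (R : realType) (n : nat) (g : R -> 'rV[R]_n) (t : R) :
  (forall s, s \in `[0, 1] -> g s = g 0) -> t \in `[0, 1] ->
  curve_deriv g t = 0.
Proof.
move=> gc t01; have PF := within_itv01_dnbhs_proper t01.
apply: cvg_lim => //; apply: cvg_near_cst.
rewrite near_withinE; apply: nearW => s s01.
by rewrite /curve_quotient (gc _ s01) (gc _ t01) subrr scaler0.
Qed.

Lemma nonconstant_curve (R : realType) (n : nat) (g : R -> 'rV[R]_n) (C : nat) :
  (0 < n)%N ->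
  hausdorff_measure (n%:R - 1)
    [set xi | unit_sphere R n xi /\
       ~ ([set t : R | t \in `[0, 1] /\ dotv (curve_deriv g t) xi = 0]
            #<= `I_C)] = 0%E ->
  exists2 t, t \in `[0, 1] & g t <> g 0.
Proof.
case: n g => // m g _ H0; apply: contrapT => gc.
have {}gc s : s \in `[0, 1] -> g s = g 0.
  by move=> s01; apply: contrapT => gs; apply: gc; exists s.
apply: (@unit_sphere_hausdorff_measure_neq0 R m).
rewrite -[RHS]H0; congr hausdorff_measure.
apply/seteqP; split; last by move=> ? [].
move=> xi xiS; split => // hC.
have fin :
    finite_set [set t : R | t \in `[0, 1] /\ dotv (curve_deriv g t) xi = 0].
  by apply/finite_set_leP; exists C.
(* The derivative vanishes identically, so the finite zero set would contain [0, 1]. *)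
have : lebesgue_measure (`[0%R, 1%R]%classic : set R) = 0%E.
  apply: countable_lebesgue_measure0; apply: finite_set_countable.
  apply: sub_finite_set fin => t /= t01; split => //.
  by rewrite curve_deriv_cst// dotvC -(scale0r 0) dotvZr mul0r.
rewrite lebesgue_measure_itvcc// subr0 => /eqP.
by rewrite eqe oner_eq0.
Qed.

(** With [v = max (1/2, f t)], the time is the infimum of those where [f <= v]. The bound 1/2 later
    keeps slopes below 2 and first coordinates of directions away from 0. *)
Lemma first_level_time (R : realType) (f : R -> R) (t : R) :
  {within `[0, 1], continuous f} -> f 0 = 1 -> t \in `[0, 1] -> f t < 1 ->
  exists v t1 : R, [/\ 2^-1 <= v < 1, t1 \in `[0, 1], f t1 = v &
    forall s, s \in `[0, t1] -> v <= f s].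
Proof.
move=> fc f0 t01 ft.
pose v := Num.max 2^-1 (f t).
have v2 : 2^-1 <= v by rewrite le_max lexx.
have ftv : f t <= v by rewrite le_max lexx orbT.
have v1 : v < 1 by rewrite gt_max ft andbT; lra.
have cont (b : R) : b \in `[0, 1] -> {within `[0, b], continuous f}.
  rewrite in_itv/= => /andP[b0 b1].
  apply: continuous_subspaceW fc => x /=; rewrite !in_itv/= => /andP[-> /=].
  by move=> /le_trans; exact.
pose S := [set s : R | s \in `[0, 1] /\ f s <= v].
have St : S t by [].
have Slb : lbound S 0 by move=> s [+ _]; rewrite in_itv/= => /andP[].
have Sinf : has_inf S by split; [exists t|exists 0].
have t10 : 0 <= inf S by apply: lb_le_inf => //; exists t.
have t1t : inf S <= t by apply: ge_inf => //; exists 0.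
have t101 : inf S \in `[0, 1].
  rewrite in_itv/= t10/=; apply: (le_trans t1t).
  by move: t01; rewrite in_itv/= => /andP[].
(* if [f (inf S) > v] then [f > v] near [inf S], against the infimum *)
have ft1 : f (inf S) <= v.
  rewrite leNgt; apply/negP => vf.
  have : \forall s \near inf S, s \in `[0, 1] -> v < f s.
    have /subspace_continuousP/(_ _ t101) := fc.
    by move=> /(_ [set y | v < y]); apply; exact: lt_nbhsr.
  move=> /nbhs_ballP[e /= e0 he].
  have [s Ss sl] := inf_adherent e0 Sinf.
  have sS : inf S <= s by apply: ge_inf => //; exists 0.
  have : v < f s.
    apply: he; last by case: Ss.
    by rewrite /ball/= distrC ger0_norm ?subr_ge0// ltrBlDl.
  by case: Ss => _; rewrite leNgt => /negbTE ->.
have before s : 0 <= s < inf S -> v < f s.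
  move=> /andP[s0 sS]; rewrite ltNge; apply/negP => fs.
  have : inf S <= s.
    apply: ge_inf; first by exists 0.
    split => //; rewrite in_itv/= s0/=; apply: ltW (lt_le_trans sS _).
    by move: t101; rewrite in_itv/= => /andP[].
  by rewrite leNgt sS.
have ft1v : f (inf S) = v.
  have [c] := @IVT R f 0 (inf S) v t10 (cont _ t101) ltac:(by
    rewrite f0 ge_min ft1 orbT/= le_max (ltW v1)).
  rewrite in_itv/= => /andP[c0]; rewrite le_eqVlt => /predU1P[->//|cS fcv].
  by have := before c; rewrite c0 cS fcv ltxx => /(_ isT).
exists v, (inf S); split => //; first by rewrite v2.
move=> s; rewrite in_itv/= => /andP[s0].
rewrite le_eqVlt => /predU1P[->|sS]; first by rewrite ft1v.
by apply/ltW/before; rewrite s0.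
Qed.

(** * Projection to the plane and the dimension bound *)

Lemma unit_sphere_dotv (R : realType) (n : nat) (x : 'rV[R]_n) :
  unit_sphere R n x -> dotv x x = 1.
Proof.
rewrite /unit_sphere/= /enorm => h.
by rewrite -[LHS]sqr_sqrtr ?h ?expr1n// ltW// -sqrtr_gt0 h.
Qed.

Lemma segments_cover_mass (R : realType) (n : nat) (g : R -> 'rV[R]_n)
    (K : set 'rV[R]_n) (t v t1 : R) :
  (forall t, t \in `[0, 1] -> unit_sphere R n (g t)) ->
  (forall u, {within `[0, 1], continuous (fun t => dotv u (g t))}) ->
  (forall w, (g @` `[0, 1]) w ->
     exists a : 'rV[R]_n, [set a + s *: w | s in `[0, 1]] `<=` K) ->
  0 < t < 1 -> 2^-1 <= v < 1 -> t1 \in `[0, 1] ->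
  dotv (g 0) (g t1) = v ->
  (forall s, s \in `[0, t1] -> v <= dotv (g 0) (g s)) ->
  exists2 c, 0 < c & forall (U : nat -> set 'rV[R]_n) (d : nat -> R),
    K `<=` \bigcup_k U k -> (forall k, 0 < d k) ->
    (forall k x y, U k x -> U k y -> enorm (x - y) <= d k) ->
    exists N, c <= \sum_(k < N) d k `^ (1 + t).
Proof.
move=> gS gc Kseg ht /andP[v2 v1] t101 gt1 gv.
have v0 : 0 < v by lra.
have unit_dotv s (s01 : s \in `[0, 1]) := unit_sphere_dotv (gS s s01).
have z01 : (0 : R) \in `[0, 1] by rewrite in_itv/= lexx ler01.
have /andP[t10 t11] : 0 <= t1 <= 1 by move: t101; rewrite in_itv.
pose u := g 0; pose w := g t1.
pose T := v^-1 - v.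
have vV : 1 < v^-1 by rewrite invf_gt1.
have T0 : 0 < T by rewrite /T; lra.
have vV2 : v^-1 <= 2 by rewrite -[leRHS]invrK lef_pV2 ?posrE ?invr_gt0.
have slope_ge x : x \in `[0, 1] -> v <= v + T * x <= v^-1.
  rewrite in_itv/= => /andP[x0 x1].
  have : 0 <= T * x by rewrite mulr_ge0// ltW.
  have : T * x <= T * 1 by rewrite ler_pM2l.
  by rewrite /T; lra.
have /choice[tau htau] x : exists s, x \in `[0, 1] -> [/\ s \in `[0, 1],
    2^-1 <= dotv u (g s) & dotv w (g s) = dotv u (g s) * (v + T * x)].
  have [x01|] := boolP (x \in `[0, 1]); last by exists 0.
  have /andP[th1 th2] := slope_ge x x01; set th := v + T * x in th1 th2 *.
  (* A zero of [h] is a direction whose projection has slope [th]; the slope is [v] at time 0 and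
     [1 / v] at [t1]. *)
  pose h s := dotv (w - th *: u) (g s).
  have hE s : h s = dotv w (g s) - th * dotv u (g s).
    by rewrite /h dotvC dotvBr dotvZr ![dotv (g s) _]dotvC.
  have h0 : h 0 <= 0.
    by rewrite hE [dotv w _]dotvC gt1 unit_dotv// mulr1 subr_le0.
  have h1 : 0 <= h t1.
    rewrite hE unit_dotv// gt1 subr_ge0.
    by rewrite -(mulVf (lt0r_neq0 v0)) ler_pM2r.
  have hc : {within `[0, t1], continuous h}.
    apply: continuous_subspaceW (gc (w - th *: u)) => y /=.
    by rewrite !in_itv/= => /andP[-> /=] /le_trans; exact.
  have [|c] := @IVT R h 0 t1 0 t10 hc.
    by rewrite ge_min h0/= le_max h1 orbT.
  move=> ct1; move: (ct1); rewrite in_itv/= => /andP[c0 ct] hc0.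
  exists c => _; split.
  - by rewrite in_itv/= c0 (le_trans ct).
  - exact: le_trans v2 (gv c ct1).
  - by apply/eqP; rewrite mulrC -subr_eq0 -hE hc0.
have /choice[a ha] x : exists a : 'rV[R]_n, x \in `[0, 1] ->
    forall r, r \in `[0, 1] -> K (a + r *: g (tau x)).
  have [x01|] := boolP (x \in `[0, 1]); last by exists 0.
  have [tx01 _ _] := htau x x01.
  have [|a0 ha0] := Kseg (g (tau x)); first by exists (tau x).
  by exists a0 => _ r r01; apply: ha0; exists r.
(* The sums are Lipschitz constants of the two projections; 2 accounts for the radii of two balls in
   [V], which thicken the projected sets to open ones. *)
pose L := \sum_i `|u 0 i| + \sum_i `|w 0 i| + 2.
have Su : 0 <= \sum_i `|u 0 i| by apply: sumr_ge0.
have Sw : 0 <= \sum_i `|w 0 i| by apply: sumr_ge0.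
have L0 : 0 < L by rewrite /L; lra.
have M0 : 0 < (6 / T + 2) * L by rewrite mulr_gt0// addr_gt0// divr_gt0.
have [t0 t_lt1] := andP ht.
exists ((24 * (4 / (1 - t)) ^+ 2)^-1 / ((6 / T + 2) * L) `^ (1 + t)).
  rewrite divr_gt0 ?powR_gt0// invr_gt0 mulr_gt0// exprn_gt0// divr_gt0//.
  by rewrite subr_gt0.
move=> U d KU d0 Ud.
pose V k : set (R * R) := \bigcup_(q in U k) ball (dotv u q, dotv w q) (d k).
have [||||x r x01 r01|N hN] := @plane_kakeya_cover_mass R t T v
    (fun k => L * d k) V (fun x => dotv u (a x)) (fun x => dotv w (a x))
    (fun x => dotv u (g (tau x))) ht T0.
- by move=> k; exact: mulr_gt0.
- by move=> k; apply: bigcup_open => q _; exact: ball_open.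
- move=> k p p' [q Uq [/= pq1 pq2]] [q' Uq' [/= pq1' pq2']].
  have hq := Ud k q q' Uq Uq'.
  have proj (b : 'rV[R]_n) (y y' : R) : \sum_i `|b 0 i| <= L - 2 ->
      ball (dotv b q) (d k) y -> ball (dotv b q') (d k) y' ->
      `|y - y'| <= L * d k.
    rewrite /ball/= => bL hy hy'.
    have hb : `|dotv b q - dotv b q'| <= (L - 2) * d k.
      rewrite -dotvBr; apply: (le_trans (norm_dotv_le _ _)).
      by apply: ler_pM => //; [exact: sumr_ge0|exact: sqrtr_ge0].
    have -> : y - y' = (dotv b q - dotv b q') - (dotv b q - y)
      + (dotv b q' - y') by ring.
    apply: (le_trans (ler_normD _ _)).
    have := ler_normB (dotv b q - dotv b q') (dotv b q - y).
    by lra.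
  by split; [apply: (proj u)|apply: (proj w)] => //; rewrite /L; lra.
- move=> x x01; have [_ ? _] := htau x x01; split => //.
  have /andP[h1 h2] := slope_ge x x01.
  by rewrite ger0_norm; lra.
- have [k _ Uk] := KU _ (ha x x01 r r01).
  exists k, (a x + r *: g (tau x)) => //.
  have [_ _ <-] := htau x x01; rewrite !dotvDr !dotvZr.
  by split; exact: ballxx.
exists N; rewrite ler_pdivrMr ?powR_gt0//; apply: (le_trans hN).
rewrite mulr_suml; apply: ler_sum => k _.
by rewrite mulrA mulrC powRM// ltW.
Qed.

Theorem theorem10 (R : realType) (n : nat) (hn : (2 <= n)%N)
    (g : R -> 'rV[R]_n)
    (g_sphere : forall t, t \in `[0, 1] -> unit_sphere R n (g t))
    (g_C1 : C1_curve g)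
    (g_card : exists C : nat,
       hausdorff_measure (n%:R - 1)
         [set xi | unit_sphere R n xi /\
            ~ ([set t : R | t \in `[0, 1] /\ dotv (curve_deriv g t) xi = 0]
                 #<= `I_C)] = 0%E)
    (K : set 'rV[R]_n)
    (K_bounded : bounded_set K)
    (K_segment : forall w, (g @` `[0, 1]) w ->
       exists a : 'rV[R]_n, [set a + s *: w | s in `[0, 1]] `<=` K) :
  (2%:E <= hausdorff_dim K)%E.
Proof.
have gc u := @dotv_curve_continuous R n g u g_C1.
have [C HC] := g_card.
have [t t01 gt0] := nonconstant_curve (ltnW hn) HC.
have z01 : (0 : R) \in `[0, 1] by rewrite in_itv/= lexx ler01.
have unit_dotv s (s01 : s \in `[0, 1]) := unit_sphere_dotv (g_sphere s s01).
(* For unit vectors, [|g t - g 0| ^ 2 = 2 - 2 * dotv (g 0) (g t)]. *)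
have ft : dotv (g 0) (g t) < 1.
  have : 0 < dotv (g t - g 0) (g t - g 0).
    rewrite lt_neqAle; apply/andP; split; last first.
      by apply: sumr_ge0 => i _; rewrite -expr2 sqr_ge0.
    rewrite eq_sym; apply/eqP => d0; apply: gt0.
    apply/rowP => i; apply/eqP; rewrite -subr_eq0 -normr_le0.
    have := norm_coord_le_enorm (g t - g 0) i.
    by rewrite /enorm d0 sqrtr0 !mxE.
  rewrite dotvBr dotvC dotvBr [dotv (_ - _) (g 0)]dotvC dotvBr !unit_dotv//.
  by rewrite [dotv (g t) _]dotvC; lra.
have [v [t1 [v2 t101 ft1 fv]]] :=
  first_level_time (gc (g 0)) (unit_dotv 0 z01) t01 ft.
apply/ereal_infP => _ [s [s0 Ks] <-]; rewrite lee_fin leNgt.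
(* For [0 <= s < 2] this puts [1 + p] strictly between [s] and 2, with [p] in (0, 1). *)
apply/negP => s2; pose p := (s + 2) / 4.
have p01 : 0 < p < 1 by apply/andP; split; rewrite /p; lra.
have [c c0 hc] :=
  segments_cover_mass g_sphere gc K_segment p01 v2 t101 ft1 fv.
have [|||U [d [KU d0 Ud sumd]]] :=
  @hausdorff_null_powR_cover R n s (1 + p) (c / 2) K Ks.
- by rewrite /p; lra.
- by apply/andP; split; rewrite /p; lra.
- by rewrite divr_gt0.
have [N hN] := hc U d KU d0 Ud.
by have := sumd N; lra.
Qed.
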